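(* Let $p$ be a prime, let $\mu : M \to P$ be a crossed module and let $\iota : P \to Q$ be a morphism of groups. If $M$, $P$ and $Q$ are finite $p$-groups, then so also is the induced crossed module $\iota_{\ast}M$ (i.e. the group $\iota_{\ast}M$ is a finite $p$-group).
   Context: A crossed module is a morphism of groups $\mu : M \to P$ together with a right action $(m,p)\mapsto m^p$ of $P$ on $M$ by automorphisms such that $\mu(m^p)=p^{-1}(\mu m)p$ and $n^{-1}mn = m^{\mu n}$ for all $m,n\in M$, $p\in P$. A morphism from a crossed module $\mu:M\to P$ to a crossed module $\nu:N\to Q$ is a pair of group morphisms $g:M\to N$, $f:P\to Q$ with $\nu g=f\mu$ and $g(m^p)=(gm)^{fp}$. A crossed $P$-module is a crossed module with codomain $P$; a morphism of crossed $P$-modules is a morphism of crossed modules which is the identity on $P$. Given a crossed module $\mu:M\to P$ and a group morphism $\iota:P\to Q$, the induced crossed module is a crossed $Q$-module $\iota_{\ast}M\to Q$ together with a morphism of crossed modules $(\bar\iota,\iota)$ from $M\to P$ to $\iota_{\ast}M\to Q$, characterised up to isomorphism by the universal property: for every crossed $Q$-module $\gamma:C\to Q$ and every morphism of crossed modules $(f,\iota)$ from $\mu:M\to P$ to $\gamma:C\to Q$, there is a unique morphism of crossed $Q$-modules $g:\iota_{\ast}M\to C$ with $g\bar\iota=f$. *)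

(* Defs.v *)
From HB Require Import structures.
From mathcomp Require Import all_boot all_fingroup all_solvable.

Set Implicit Arguments.
Unset Strict Implicit.
Unset Printing Implicit Defensive.

Local Open Scope group_scope.

(* Groups are [groupType]s, which need not be finite: the universal property  *)
(* of an induced crossed module ranges over arbitrary groups. Their morphisms *)
(* [{multiplicative G -> H}] preserve products, hence units and inverses.     *)

(* [x ^ y] is the conjugate [y^-1 * (x * y)] of [x] by [y].                   *)
Record crossedModule (M P : groupType) := CrossedModule {
  cm_map :> {multiplicative M -> P};
  cm_act : M -> P -> M;
  cm_act1 : forall m, cm_act m 1 = m;
  cm_actM : forall m p q, cm_act m (p * q) = cm_act (cm_act m p) q;
  cm_mulA : forall m n p, cm_act (m * n) p = cm_act m p * cm_act n p;
  cm_equiv : forall m p, cm_map (cm_act m p) = cm_map m ^ p;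
  cm_peiffer : forall m n, cm_act m (cm_map n) = m ^ n
}.

Definition is_cm_morphism (M P N Q : groupType)
    (mu : crossedModule M P) (nu : crossedModule N Q)
    (g : {multiplicative M -> N}) (f : {multiplicative P -> Q}) : Prop :=
  (forall m, nu (g m) = f (mu m)) /\
  (forall m p, g (cm_act mu m p) = cm_act nu (g m) (f p)).

Definition is_cm_morphism_over (M N P : groupType)
    (mu : crossedModule M P) (nu : crossedModule N P)
    (g : {multiplicative M -> N}) : Prop :=
  is_cm_morphism mu nu g idfun.

Definition is_induced (M P Q I : groupType)
    (mu : crossedModule M P) (iota : {multiplicative P -> Q})
    (del : crossedModule I Q) (ibar : {multiplicative M -> I}) : Prop :=
  is_cm_morphism mu del ibar iota /\
  (forall (C : groupType) (gamma : crossedModule C Q)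
          (f : {multiplicative M -> C}),
     is_cm_morphism mu gamma f iota ->
     exists g : {multiplicative I -> C},
       [/\ is_cm_morphism_over del gamma g,
           (forall m, g (ibar m) = f m)
         & forall g' : {multiplicative I -> C},
             is_cm_morphism_over del gamma g' ->
             (forall m, g' (ibar m) = f m) -> forall x, g' x = g x]).

(* [p.-group] is only available over a [finGroupType], so finiteness is       *)
(* expressed by an isomorphism with such a type.                              *)
Definition finite_pgroup (p : nat) (G : groupType) : Prop :=
  exists (H : finGroupType) (h : {multiplicative G -> H}),
    bijective h /\ p.-group [set: H].

(* Main.v *)
Require Import Defs.
From HB Require Import structures.
From mathcomp Require Import all_boot all_fingroup all_solvable.

Set Implicit Arguments.
Unset Strict Implicit.
Unset Printing Implicit Defensive.

Local Open Scope group_scope.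

(** Let [del : I -> Q] be the induced crossed module, with its canonical map
    [ibar : M -> I]. The elements [(ibar m)^q], for [m] in [M] and [q] in [Q],
    form a finite subset [S] of [I]. It is closed under conjugation, because
    conjugation by [y] in [I] is the action of [del y], and each element of [S]
    has finite order dividing the order of [M]. By Dietzmann's lemma
    ([Dietzmann]), the set [J] of products of elements of [S] is a finite
    subgroup of [I].

    The subgroup [J] is stable under the action of [Q], hence is itself a
    crossed [Q]-module through which [ibar] factors; the universal property
    then makes the inclusion of [J] in [I] surjective ([induced_sub_section]),
    so that [I] is finite.

    Finally the kernel of [del] is central, by the Peiffer identity, and its
    image is a subgroup of the [p]-group [Q], so [I] is a central extension of
    a [p]-group and is therefore nilpotent ([nilpotent_central_ext]). A
    nilpotent finite group generated by [p]-elements, as [I] is by [S], is a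
    [p]-group ([nilpotent_gen_pgroup]). *)

(** * Dietzmann's lemma *)

Section Dietzmann.

Variables (G : groupType) (S : seq G).
Hypothesis S_conj : {in S &, forall x y, x ^ y \in S}.

Lemma conjXg_in x y n : x \in S -> y \in S -> x ^ (y ^+ n) \in S.
Proof.
move=> Sx Sy; elim: n => [|n IHn]; first by rewrite expg0 conjg1.
by rewrite expgSr conjgM S_conj.
Qed.

(** All the occurrences of the letter [x] in a word over [S] can be moved to the
    front: passing over a power of [x] replaces a letter by its conjugate. *)
Lemma collect_letter x (w : seq G) : x \in S -> {subset w <= S} ->
  exists2 w' : seq G, {subset w' <= S} &
    size w = count_mem x w + size w' /\
    \prod_(y <- w) y = x ^+ count_mem x w * \prod_(y <- w') y.
Proof.
move=> Sx; elim: w => [|y w IHw] Sw.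
  by exists [::] => //; rewrite expg0 mul1g.
have Sy : y \in S by rewrite Sw ?mem_head.
have [|w' Sw' [szw prodw]] := IHw.
  by move=> z wz; rewrite Sw // inE wz orbT.
rewrite big_cons prodw /=; have [->|_] := eqVneq y x.
  by exists w' => //; rewrite szw expgS mulgA.
exists (y ^ (x ^+ count_mem x w) :: w').
  by move=> z; rewrite inE => /predU1P[->|/Sw' //]; apply: conjXg_in.
rewrite /= szw addnS add0n big_cons; split=> //.
  by rewrite mulgA [y * _]conjgC -mulgA.
Qed.

End Dietzmann.

(** A pigeonhole principle for the letters of a word. *)
Lemma size_le_count (T : eqType) (S w : seq T) (n : nat) :
  {subset w <= S} -> {in S, forall x, count_mem x w <= n} ->
  size w <= size S * n.
Proof.
elim: S w => [|x S IHS] w Sw cw.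
  by case: w Sw {cw} => // y w /(_ y); rewrite mem_head => /(_ isT).
rewrite -(count_predC (pred1 x) w) /= mulSn leq_add ?cw ?mem_head //.
rewrite -size_filter; apply: IHS => [y|y Sy].
  by rewrite mem_filter /= => /andP[/negPf yx /Sw]; rewrite inE yx.
apply: leq_trans (cw y _); last by rewrite inE Sy orbT.
by rewrite count_filter; apply: sub_count => z /andP[].
Qed.

(** The products of words of length at most [n] over the finite set [S]. *)
Fixpoint short_products (G : groupType) (S : seq G) (n : nat) : seq G :=
  if n is n'.+1 then
    1 :: [seq x * y | x <- S, y <- short_products S n']
  else [:: 1].

Lemma short_productsP (G : groupType) (S : seq G) n x :
  reflect (exists2 w : seq G, {subset w <= S} &
             size w <= n /\ x = \prod_(y <- w) y)
          (x \in short_products S n).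
Proof.
apply: (iffP idP) => [|[w Sw [szw ->{x}]]].
  elim: n x => [|n IHn] x /=.
    by rewrite inE => /eqP->; exists [::] => //; rewrite big_nil.
  rewrite inE => /predU1P[->|/allpairsP[[y z] /= [Sy /IHn[w Sw [szw ->]] ->]]].
    by exists [::] => //; rewrite big_nil.
  exists (y :: w); last by rewrite big_cons.
  by move=> t; rewrite inE => /predU1P[->|/Sw].
elim: n w Sw szw => [|n IHn] [|y w] //= Sw szw; rewrite ?big_nil ?mem_head //.
rewrite big_cons inE; apply/orP; right; apply: allpairs_f.
  by rewrite Sw ?mem_head.
by apply: IHn => // z wz; rewrite Sw // inE wz orbT.
Qed.

(** A word of length greater than [size S * n] contains more than [n] copies of
    some letter [x]; collecting them at the front makes a factor [x ^+ n = 1]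
    appear, which can be erased. So every product of elements of [S] is the
    product of a word of length at most [size S * n]. *)
Lemma finite_products (G : groupType) (S : seq G) (n : nat) : 0 < n ->
  {in S, forall x, x ^+ n = 1} -> {in S &, forall x y, x ^ y \in S} ->
  exists T : seq G, forall x,
    x \in T <-> exists2 w : seq G, {subset w <= S} & x = \prod_(y <- w) y.
Proof.
move=> n_gt0 Sn S_conj; exists (short_products S (size S * n)) => x.
split=> [/short_productsP[w Sw [_ ->]]|[w Sw ->{x}]]; first by exists w.
apply/short_productsP.
have [m] := ubnP (size w); elim: m w Sw => // m IHm w Sw lewm.
have [/allP/(size_le_count Sw) le_w|/allPn[x Sx]] :=
    boolP (all (fun x => count_mem x w <= n) S); first by exists w.
rewrite -ltnNge => ltnx; have [w' Sw' [szw ->]] := collect_letter S_conj Sx Sw.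
set c := count_mem x w in ltnx szw *.
have Sv : {subset nseq (c - n) x ++ w' <= S}.
  by move=> y; rewrite mem_cat mem_nseq => /orP[/andP[_ /eqP->]|/Sw'].
have [|v Sv' [szv prodv]] := IHm _ Sv.
  rewrite size_cat size_nseq; apply: leq_trans (lewm : size w <= m).
  by rewrite szw ltn_add2r ltn_subrL n_gt0 (leq_ltn_trans _ ltnx).
exists v => //; split=> //; rewrite -prodv big_cat /=; congr (_ * _).
rewrite big_nseq -[in LHS](subnK (ltnW ltnx)) expgnDr Sn // mulg1.
by elim: (c - n) => //= k <-; rewrite expgS.
Qed.

(** A finite sequence [T] that contains [1] and is closed under products and
    inverses is the image of a finite group [J] under an injective morphism [j].
    The map [r] inverts [j] on [T]; its values outside [T] are irrelevant. *)
Lemma finGroup_of_seq (G : groupType) (T : seq G) :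
  1 \in T -> {in T &, forall x y, x * y \in T} ->
  {in T, forall x, x^-1 \in T} ->
  exists (J : finGroupType) (j : {multiplicative J -> G}) (r : G -> J),
    [/\ cancel j r, {in T, cancel r j} & forall x, j x \in T].
Proof.
move=> T1 TM TV; pose S := seq_sub T.
pose one : S := SeqSub T1.
pose mul (x y : S) : S := SeqSub (TM _ _ (valP x) (valP y)).
pose inv (x : S) : S := SeqSub (TV _ (valP x)).
have mulA : associative mul by move=> x y z; apply/val_inj/mulgA.
have mul1 : left_id one mul by move=> x; apply/val_inj/mul1g.
have mulV : left_inverse one inv mul by move=> x; apply/val_inj/mulVg.
pose J : finGroupType := HB.pack S (Finite_isGroup.Build S mulA mul1 mulV).
have valM : {morph (fun x : J => ssval x) : x y / x * y} by [].
pose j : {multiplicative J -> G} :=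
  HB.pack (fun x : J => ssval x) (isMultiplicative.Build J G _ valM).
exists J, j, (insubd one); split=> [x|x Tx|x].
- exact: (valKd one x).
- exact: (insubdK one Tx).
- exact: valP x.
Qed.


(** Dietzmann's lemma: a finite set [S] of elements of finite order that is
    closed under conjugation by its own elements generates a finite subgroup.
    The subgroup is given by an embedding [j] of a finite group [J]; its elements
    are those fixed by [j \o r], and are exactly the products of words over
    [S]. *)
Theorem Dietzmann (G : groupType) (S : seq G) (n : nat) : 0 < n ->
  {in S, forall x, x ^+ n = 1} -> {in S &, forall x y, x ^ y \in S} ->
  exists (J : finGroupType) (j : {multiplicative J -> G}) (r : G -> J),
    cancel j r /\ forall x, j (r x) = x <->
      exists2 w : seq G, {subset w <= S} & x = \prod_(y <- w) y.
Proof.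
move=> n_gt0 Sn S_conj; have [T memT] := finite_products n_gt0 Sn S_conj.
have T1 : 1 \in T by apply/memT; exists [::]; rewrite ?big_nil.
have TM : {in T &, forall x y, x * y \in T}.
  move=> _ _ /memT[v Sv ->] /memT[w Sw ->]; apply/memT; exists (v ++ w).
    by move=> z; rewrite mem_cat => /orP[/Sv|/Sw].
  by rewrite big_cat.
have TX x k : x \in S -> x ^+ k \in T.
  move=> Sx; elim: k => // k IHk; rewrite expgS TM //; apply/memT.
  by exists [:: x]; rewrite ?big_seq1 // => y; rewrite inE => /eqP->.
have TV : {in T, forall x, x^-1 \in T}.
  move=> _ /memT[w Sw ->]; elim: w Sw => [|x w IHw] Sxw.
    by rewrite big_nil invg1.
  rewrite big_cons invgM TM //.
    by rewrite IHw // => y wy; rewrite Sxw // inE wy orbT.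
  have Sx : x \in S by rewrite Sxw ?mem_head.
  (* As [x] has finite order, its inverse is a positive power of it. *)
  suff -> : x^-1 = x ^+ n.-1 by apply: TX.
  by apply: (mulgI x); rewrite mulgV -expgS prednK // Sn.
have [J [j [r [jK rK Tj]]]] := finGroup_of_seq T1 TM TV.
exists J, j, r; split=> // x; split=> [<-|/memT/rK //].
exact/memT.
Qed.

(** * Crossed modules *)

Lemma multiplicative1 (G H : groupType) (f : {multiplicative G -> H}) : f 1 = 1.
Proof. by apply: (mulgI (f 1)); rewrite -gmulfM !mulg1. Qed.

(** A multiplicative map between groups, as a morphism of monoids; this gives
    access to the theory of images of powers, products and inverses. *)
Definition group_morphism (G H : groupType) (f : {multiplicative G -> H}) :
    UMagmaMorphism.type G H :=
  let phi : G -> H := f in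
  HB.pack phi (isUMagmaMorphism.Build G H phi (multiplicative1 f, @gmulfM _ _ f)).

Section CrossedModuleTheory.

Variables (M P : groupType) (mu : crossedModule M P).

(** The endomorphism of [M] given by the action of [p]. *)
Definition act_morphism (p : P) : UMagmaMorphism.type M M :=
  group_morphism
    (HB.pack (fun m => cm_act mu m p)
       (isMultiplicative.Build M M _ (fun m n => cm_mulA mu m n p))).

(** By the Peiffer identity, an element of the kernel conjugates trivially. *)
Lemma cm_ker_central m : mu m = 1 -> forall n, commute m n.
Proof.
move=> mu1 n; apply: commute_sym; apply/commgP; apply/conjg_fixP.
by rewrite -(cm_peiffer mu) mu1 cm_act1.
Qed.

End CrossedModuleTheory.

(** A subgroup of [I] that is stable under the action of [Q] is a crossed
    [Q]-module. The subgroup is given by an embedding [j] with retraction [r],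
    and its elements are those fixed by [j \o r]. *)
Lemma sub_crossedModule (I J Q : groupType) (del : crossedModule I Q)
    (j : {multiplicative J -> I}) (r : I -> J) :
  cancel j r ->
  (forall x q, j (r (cm_act del (j x) q)) = cm_act del (j x) q) ->
  exists nu : crossedModule J Q, is_cm_morphism_over nu del j.
Proof.
move=> jK rK; have j_inj := can_inj jK.
pose act x q := r (cm_act del (j x) q).
have nuM : {morph (fun x => del (j x)) : x y / x * y}.
  by move=> x y; rewrite !gmulfM.
pose nu : {multiplicative J -> Q} :=
  HB.pack (fun x => del (j x)) (isMultiplicative.Build J Q _ nuM).
have act1 m : act m 1 = m by rewrite /act cm_act1 jK.
have actM m q1 q2 : act m (q1 * q2) = act (act m q1) q2.
  by rewrite /act rK cm_actM.
have mulA m n q : act (m * n) q = act m q * act n q.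
  by apply: j_inj; rewrite rK !gmulfM !rK cm_mulA.
have equiv m q : nu (act m q) = nu m ^ q.
  by rewrite /nu /= rK cm_equiv.
have peiffer m n : act m (nu n) = m ^ n.
  by rewrite /act cm_peiffer -(gmulfJ (group_morphism j)) /= jK.
by exists (CrossedModule act1 actM mulA equiv peiffer).
Qed.

(** The induced crossed module has no proper sub-crossed module containing the
    image of [ibar]: if [ibar] factors through [j : J -> I], then the morphism
    [g : I -> J] produced by the universal property of [I] is a section of [j],
    because [j \o g] and the identity both extend [ibar]. *)
Lemma induced_sub_section (M P Q I J : groupType) (mu : crossedModule M P)
    (iota : {multiplicative P -> Q}) (del : crossedModule I Q)
    (ibar : {multiplicative M -> I}) (nu : crossedModule J Q)
    (j : {multiplicative J -> I}) (f : {multiplicative M -> J}) :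
  is_induced mu iota del ibar -> is_cm_morphism_over nu del j ->
  is_cm_morphism mu nu f iota -> (forall m, j (f m) = ibar m) ->
  exists g : {multiplicative I -> J}, cancel g j.
Proof.
move=> [ibar_mor univ] [j_map j_act] f_mor jf.
have [g [[g_map g_act] gf _]] := univ J nu f f_mor.
have [h [_ _ h_uniq]] := univ I del ibar ibar_mor.
exists g => x; rewrite [RHS](h_uniq idfun) //.
apply: (h_uniq (j \o g)) => [|m] /=; last by rewrite gf jf.
by split=> [y|y q] /=; rewrite ?j_map ?g_map ?g_act ?j_act.
Qed.

(** * Central extensions of p-groups *)

Lemma nilpotent_central_ext (p : nat) (gT rT : finGroupType) (G : {group gT})
    (f : {morphism G >-> rT}) :
  'ker f \subset 'Z(G) -> p.-group (f @* G) -> nilpotent G.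
Proof.
move=> sKZ pfG; rewrite -quotient_center_nil; apply: (@pgroup_nil _ p).
rewrite /pgroup card_quotient ?(normal_norm (center_normal G)) //.
by apply: pnat_dvd pfG; rewrite card_morphim setIid indexgS.
Qed.

Lemma nilpotent_gen_pgroup (p : nat) (gT : finGroupType) (G : {group gT}) :
  nilpotent G -> G \subset <<[set x in G | p.-elt x]>> -> p.-group G.
Proof.
move=> nilG sGgen; apply: pgroupS (pcore_pgroup p G).
apply: subset_trans sGgen _; rewrite gen_subG; apply/subsetP=> x.
by rewrite inE => /andP[Gx]; rewrite (mem_Hall_pcore (nilpotent_pcore_Hall _ _)).
Qed.

(** * Induced crossed modules of p-groups *)

Theorem corollary4p3 (p : nat) (hp : prime p) (M P Q : groupType)
    (mu : crossedModule M P) (iota : {multiplicative P -> Q})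
    (hM : finite_pgroup p M) (hP : finite_pgroup p P) (hQ : finite_pgroup p Q)
    (I : groupType) (del : crossedModule I Q) (ibar : {multiplicative M -> I})
    (hI : is_induced mu iota del ibar) :
  finite_pgroup p I.
Proof.
have [[ibar_map ibar_act] _] := hI.
have [HM [hm [[hm' hmK hm'K] pHM]]] := hM.
have [HQ [hq [[hq' hqK hq'K] pHQ]]] := hQ.
(* [S] is the set of all [(ibar m)^q]. *)
pose S := [seq cm_act del (ibar (hm' x)) (hq' y) | x <- enum HM, y <- enum HQ].
have memS x : x \in S <-> exists m q, x = cm_act del (ibar m) q.
  split=> [/allpairsP[[y z] [_ _ ->]]|[m [q ->]]]; first by do 2!eexists.
  by rewrite -[m]hmK -[q]hqK; apply: allpairs_f; rewrite mem_enum.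
pose n := #|[set: HM]|.
have Mn (m : M) : m ^+ n = 1.
  apply: (can_inj hmK); rewrite (gmulfXn (group_morphism hm)) /=.
  by rewrite multiplicative1 expg_cardG ?inE.
have Sn : {in S, forall x, x ^+ n = 1}.
  move=> _ /memS[m [q ->]]; rewrite -(gmulfXn (act_morphism del q)) /=.
  rewrite -(gmulfXn (group_morphism ibar)) Mn /= multiplicative1.
  exact: (multiplicative1 (act_morphism del q)).
have S_act x q : x \in S -> cm_act del x q \in S.
  by case/memS=> m [q' ->]; apply/memS; exists m, (q' * q); rewrite cm_actM.
have S_conj : {in S &, forall x y, x ^ y \in S}.
  by move=> x y Sx _; rewrite -(cm_peiffer del) S_act.
(* [J] is the finite subgroup of [I] generated by [S]. *)
have [J [j [r [jK rK]]]] := Dietzmann (cardG_gt0 _) Sn S_conj.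
have [x q|nu j_mor] := sub_crossedModule (del := del) jK.
  (* [J] is stable under the action, which permutes [S]. *)
  apply/rK; have /rK[w Sw {1}->] := congr1 j (jK x).
  exists [seq cm_act del y q | y <- w].
    by move=> _ /mapP[y /Sw Sy ->]; apply: S_act.
  by rewrite big_map; apply: (gmulf_prod (act_morphism del q)).
have ibarK m : j (r (ibar m)) = ibar m.
  apply/rK; exists [:: ibar m]; last by rewrite big_seq1.
  move=> y; rewrite inE => /eqP->; apply/memS.
  by exists m, 1; rewrite cm_act1.
have fM : {morph r \o ibar : m n / m * n}.
  by move=> a b; apply: (can_inj jK); rewrite /= ibarK !gmulfM !ibarK.
pose f : {multiplicative M -> J} :=
  HB.pack (r \o ibar) (isMultiplicative.Build M J _ fM).
have f_mor : is_cm_morphism mu nu f iota.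
  case: j_mor => j_map j_act; split=> [m|m q].
    by rewrite -[LHS]j_map /= ibarK.
  by apply: (can_inj jK); rewrite j_act /= !ibarK.
have [g gK] := induced_sub_section hI j_mor f_mor ibarK.
(* [g] is an isomorphism from [I] to the finite group [J]. *)
exists J, g; split.
  by exists j => // x; apply: (can_inj jK).
pose d x := hq (del (j x)).
have dM : {in [set: J] &, {morph d : x y / x * y}}.
  by move=> x y _ _; rewrite /d !gmulfM.
apply: nilpotent_gen_pgroup.
  apply: (@nilpotent_central_ext p _ _ _ (Morphism dM)); last first.
    exact: pgroupS (subsetT _) pHQ.
  apply/subsetP=> x /morphpreP[_ /set1P/= dx1].
  apply/centerP; split=> [|y _]; first by rewrite inE.
  apply: (can_inj jK); rewrite !gmulfM; apply: (@cm_ker_central _ _ del).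
  by apply: (can_inj hqK); rewrite multiplicative1.
(* [J] is generated by [S], whose elements have order dividing that of [M]. *)
apply/subsetP=> y _.
have /rK[w Sw jy] := congr1 j (jK y).
have Srt s : s \in S -> j (r s) = s.
  move=> Ss; apply/rK; exists [:: s]; last by rewrite big_seq1.
  by move=> z; rewrite inE => /eqP->.
have -> : y = \prod_(s <- w) r s.
  apply: (can_inj jK); rewrite jy (gmulf_prod (group_morphism j)) /=.
  by apply: eq_big_seq => s /Sw/Srt->.
rewrite big_seq; apply: group_prod => s /Sw Ss; apply: mem_gen; rewrite !inE /=.
apply: pnat_dvd (pHM); rewrite order_dvdn; apply/eqP/(can_inj jK).
by rewrite (gmulfXn (group_morphism j)) /= Srt // Sn // multiplicative1.
Qed.
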